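(* Over the real field $\mathbb{R}$, up to isomorphism, the non-trivial $2$-dimensional left unital algebras are exactly the following pairwise non-isomorphic algebras (each is left unital, and every non-trivial $2$-dimensional real left unital algebra is isomorphic to exactly one of them), given by their matrices of structure constants (MSC): \begin{itemize} \item $A_{1,r}\left(\alpha_1,\frac{\alpha_1(1-\alpha_1)}{\beta_1}-\frac{1}{2},\frac{\alpha_1(1-\alpha_1)^2}{\beta^2_1}-\frac{1-\alpha_1}{2\beta_1},\beta_1\right)=\left(\begin{array}{cccc}\alpha_1 & \frac{2\alpha_1-2\alpha_1^2-\beta_1}{2\beta_1} & \frac{2\alpha_1-2\alpha_1^2+\beta_1}{2\beta_1} & \frac{2\alpha_1-4\alpha_1^2+2\alpha_1^3-\beta_1+\alpha_1\beta_1}{2\beta_1^2}\\ \beta_1 & -\alpha_1 & 1-\alpha_1 & \frac{-2\alpha_1+2\alpha_1^2+\beta_1}{2\beta_1}\end{array}\right)$, where $\alpha_1,\beta_1\in\mathbb{R}$, $\beta_1\neq 0$; \item $A_{1,r}\left(1,\alpha_2,\frac{\alpha_2(2\alpha_2+1)}{2},0\right)=\left(\begin{array}{cccc}1 & \alpha_2 & 1+\alpha_2 & \frac{1}{2}(\alpha_2+2\alpha_2^2)\\ 0 & -1 & 0 & -\alpha_2\end{array}\right)$, where $\alpha_2\in\mathbb{R}$; \item $A_{2,r}(\alpha_1,0,\alpha_1)=\left(\begin{array}{cccc}\alpha_1 & 0 & 0 & 1\\ 0 & \alpha_1 & -\alpha_1+1 & 0\end{array}\right)$, where $\alpha_1\in\mathbb{R}$,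 $\alpha_1\neq 0$; \item $A_{3,r}(\alpha_1,0,\alpha_1)=\left(\begin{array}{cccc}\alpha_1 & 0 & 0 & -1\\ 0 & \alpha_1 & -\alpha_1+1 & 0\end{array}\right)$, where $\alpha_1\in\mathbb{R}$, $\alpha_1\neq 0$; \item $A_{5,r}(\alpha_1,\alpha_1)=\left(\begin{array}{cccc}\alpha_1 & 0 & 0 & 0\\ 0 & \alpha_1 & -\alpha_1+1 & 0\end{array}\right)$, where $\alpha_1\in\mathbb{R}$, $\alpha_1\neq 0$; \item $A_{7,r}\left(\frac{1}{2},0\right)=\left(\begin{array}{cccc}\frac{1}{2} & 0 & 0 & 1\\ 0 & \frac{1}{2} & -\frac{1}{2} & 0\end{array}\right)$; \item $A_{8,r}\left(\frac{1}{2},0\right)=\left(\begin{array}{cccc}\frac{1}{2} & 0 & 0 & -1\\ 0 & \frac{1}{2} & -\frac{1}{2} & 0\end{array}\right)$; \item $A_{10,r}\left(\frac{1}{2}\right)=\left(\begin{array}{cccc}\frac{1}{2} & 0 & 0 & 0\\ 0 & \frac{1}{2} & -\frac{1}{2} & 0\end{array}\right)$. \end{itemize} (Different families, and different parameter values within a family, give non-isomorphic algebras.)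
   Context: A real algebra is a vector space $\mathbb{A}$ over $\mathbb{R}$ with a bilinear multiplication (not assumed associative, commutative or unital). It is non-trivial if its multiplication is not identically zero. For a $2$-dimensional algebra with basis $(e_1,e_2)$, its matrix of structure constants (MSC) is the $2\times 4$ real matrix $A=\left(\begin{array}{cccc}\alpha_1&\alpha_2&\alpha_3&\alpha_4\\ \beta_1&\beta_2&\beta_3&\beta_4\end{array}\right)$ with $e_1e_1=\alpha_1e_1+\beta_1e_2$, $e_1e_2=\alpha_2e_1+\beta_2e_2$, $e_2e_1=\alpha_3e_1+\beta_3e_2$, $e_2e_2=\alpha_4e_1+\beta_4e_2$; equivalently, in coordinate columns, the product of $u$ and $v$ is $A(u\otimes v)$ with $\otimes$ the Kronecker product. An algebra is identified with its MSC. Two algebras with MSCs $A$ and $B$ are isomorphic iff $B=gA(g^{-1})^{\otimes 2}$ for some $g\in GL(2;\mathbb{R})$. An algebra $\mathbb{A}$ is left unital if there is an element $\mathbf{1}_L\in\mathbb{A}$ with $\mathbf{1}_L\cdot\mathbf{u}=\mathbf{u}$ for all $\mathbf{u}\in\mathbb{A}$. The symbols $A_{i,r}(\cdot)$ are just names; the algebras meant are those given by the explicit matrices. *)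

(* Defs.v *)
From HB Require Import structures.
From mathcomp Require Import all_boot all_order all_algebra.
From mathcomp Require Import mxtens.

Set Implicit Arguments.
Unset Strict Implicit.
Unset Printing Implicit Defensive.

Import GRing.Theory.
Local Open Scope ring_scope.

Section Algebras.
Variable K : fieldType.

(* An algebra (not assumed associative, commutative or unital) is a vectType V
   with a multiplication mul : {bilinear V -> V -> V}. *)

Definition nontrivial (V : vectType K) (mul : {bilinear V -> V -> V}) : Prop :=
  exists u v : V, mul u v <> 0.

Definition left_unital (V : vectType K) (mul : {bilinear V -> V -> V}) : Prop :=
  exists e : V, forall u : V, mul e u = u.

Definition isomorphic (V W : vectType K) (mulV : {bilinear V -> V -> V})
    (mulW : {bilinear W -> W -> W}) : Prop :=
  exists f : {linear V -> W},
    bijective f /\ forall u v : V, f (mulV u v) = mulW (f u) (f v).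

(* The multiplication on K^2 whose MSC in the standard basis is A. Up to
   conversion u *t v is a column of height 4; its entries are indexed in the
   order e1e1, e1e2, e2e1, e2e2. *)
Definition msc_mul (A : 'M[K]_(2, 4)) (u v : 'cV[K]_2) : 'cV[K]_2 :=
  A *m (u *t v).

Lemma msc_mul_bilinear (A : 'M[K]_(2, 4)) :
  bilinear_for
    (GRing.Scale.Law.clone _ _ *:%R _) (GRing.Scale.Law.clone _ _ *:%R _)
    (msc_mul A).
Proof.
split=> w k x y; rewrite /msc_mul /= scalemxAr -mulmxDr; congr (A *m _);
  apply/matrixP=> i j; rewrite !mxE.
- by rewrite mulrDl mulrA.
- by rewrite mulrDr mulrCA.
Qed.

HB.instance Definition _ (A : 'M[K]_(2, 4)) :=
  bilinear_isBilinear.Build K 'cV[K]_2 'cV[K]_2 'cV[K]_2 *:%R *:%R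
    (msc_mul A) (msc_mul_bilinear A).

Lemma msc_mul_delta (A : 'M[K]_(2, 4)) (i j : 'I_2) :
  msc_mul A (delta_mx i 0) (delta_mx j 0) =
  col (mxtens_index (i, j) : 'I_(2 * 2)) A.
Proof.
apply/matrixP=> k l; rewrite !mxE (bigD1 (mxtens_index (i, j))) //=.
rewrite big1 => [|m Nm].
  by rewrite !mxE mxtens_indexK /= !eqxx !ord1 /= !mulr1 addr0.
rewrite !mxE; case: (@mxtens_indexP 2 2 m) Nm => a b; rewrite mxtens_indexK /=.
case: (eqVneq a i) => [->|_]; last by rewrite /= mul0r mulr0.
case: (eqVneq b j) => [->|_]; last by rewrite /= !mulr0.
by rewrite eqxx.
Qed.

Lemma isomorphic_mscP (A B : 'M[K]_(2, 4)) :
  isomorphic (msc_mul A) (msc_mul B) <->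
  exists2 g : 'M[K]_2,
    g \in unitmx & B = g *m A *m (invmx g *t invmx g).
Proof.
split=> [[f [[f' fK f'K] fM]]|[g gU ->]].
- pose g : 'M[K]_2 := \matrix_(i, j) f (delta_mx j 0) i 0.
  have fE u : f u = g *m u.
    rewrite {1}(matrix_sum_delta u) linear_sum /=.
    apply/matrixP=> i j; rewrite !mxE summxE; apply: eq_bigr => k _.
    rewrite big_ord1 linearZ !mxE !ord1 mulrC.
    by congr (_ * _); congr (f (delta_mx _ _) _ _).
  have gU : g \in unitmx.
    pose h : 'M[K]_2 := \matrix_(i, j) f' (delta_mx j 0) i 0.
    apply: (proj1 (@mulmx1_unit _ _ g h _)).
    apply/matrixP=> i j.
    have -> : (g *m h) i j = (g *m f' (delta_mx j 0)) i 0.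
      by rewrite !mxE; apply: eq_bigr => k _; rewrite !mxE.
    by rewrite -fE f'K !mxE eqxx andbT.
  have gA : g *m A = B *m (g *t g).
    have colE (M : 'M[K]_(2, 4)) (i j : 'I_2) k :
        M k (mxtens_index (i, j) : 'I_(2 * 2)) =
        msc_mul M (delta_mx i 0) (delta_mx j 0) k 0.
      by rewrite msc_mul_delta mxE.
    apply/matrixP=> k m; case: (@mxtens_indexP 2 2 m) => i j.
    rewrite !colE; congr (_ _ _ _).
    have E : f (msc_mul A (delta_mx i 0) (delta_mx j 0)) =
             msc_mul B (f (delta_mx i 0)) (f (delta_mx j 0)) by exact: fM.
    move: E; rewrite !fE /msc_mul -!mulmxA => ->.
    by rewrite -(tensmx_mul g g (delta_mx i 0) (delta_mx j 0)).
  exists g => //; rewrite gA -mulmxA (tensmx_mul g g (invmx g) (invmx g)) !mulmxV //.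
  suff -> : 1%:M *t 1%:M = 1%:M :> 'M[K]_(2 * 2) by rewrite mulmx1.
  apply/matrixP=> a b; case: (@mxtens_indexP 2 2 a) => i j;
    case: (@mxtens_indexP 2 2 b) => k l.
  rewrite tensmxE !mxE (can_eq (@mxtens_indexK 2 2)) xpair_eqE.
  by case: (i == k); case: (j == l); rewrite ?mulr1 ?mulr0.
- pose f := mulmx g : {linear 'cV[K]_2 -> 'cV[K]_2}.
  exists f; split.
    by exists (mulmx (invmx g)) => u; rewrite /f /= ?mulKmx ?mulKVmx.
  move=> u v; rewrite /f /= /msc_mul -!mulmxA; congr (_ *m (_ *m _)).
  by rewrite (tensmx_mul (invmx g) (invmx g) (g *m u) (g *m v)) !mulKmx.
Qed.

Definition msc (a1 a2 a3 a4 b1 b2 b3 b4 : K) : 'M[K]_(2, 4) :=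
  \matrix_(i < 2, j < 4)
    nth 0 (nth [::] [:: [:: a1; a2; a3; a4];
                        [:: b1; b2; b3; b4]] i) j.

(* One constructor for each family, with its parameters; A1_gen and A1_spec are
   the two families named A_{1,r} (beta_1 <> 0 and beta_1 = 0). *)
Inductive canon :=
  | A1_gen of K & K
  | A1_spec of K
  | A2 of K
  | A3 of K
  | A5 of K
  | A7
  | A8
  | A10.

Definition admissible (c : canon) : Prop :=
  match c with
  | A1_gen a b => b <> 0
  | A2 a | A3 a | A5 a => a <> 0
  | A1_spec _ | A7 | A8 | A10 => True
  end.

Definition canon_msc (c : canon) : 'M[K]_(2, 4) :=
  match c with
  | A1_gen a b =>
      msc a ((2 * a - 2 * a ^+ 2 - b) / (2 * b))
            ((2 * a - 2 * a ^+ 2 + b) / (2 * b))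
            ((2 * a - 4 * a ^+ 2 + 2 * a ^+ 3 - b + a * b) / (2 * b ^+ 2))
          b (- a) (1 - a) ((- (2 * a) + 2 * a ^+ 2 + b) / (2 * b))
  | A1_spec a =>
      msc 1 a    (1 + a) (1 / 2 * (a + 2 * a ^+ 2))
          0 (-1) 0       (- a)
  | A2 a => msc a 0 0         1
                0 a (- a + 1) 0
  | A3 a => msc a 0 0         (-1)
                0 a (- a + 1) 0
  | A5 a => msc a 0 0         0
                0 a (- a + 1) 0
  | A7   => msc (1 / 2) 0       0           1
                0       (1 / 2) (- (1 / 2)) 0
  | A8   => msc (1 / 2) 0       0           (-1)
                0       (1 / 2) (- (1 / 2)) 0
  | A10  => msc (1 / 2) 0       0           0
                0       (1 / 2) (- (1 / 2)) 0
  end.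

End Algebras.

(* Main.v *)
Require Import Defs.
From HB Require Import structures.
From mathcomp Require Import all_boot all_order all_algebra.
From mathcomp Require Import mxtens reals.
From mathcomp Require Import ring lra.
Import Order.TTheory GRing.Theory Num.Theory.

Local Open Scope ring_scope.

(* The traces of left and right multiplication, [u |-> tr L_u] and
   [u |-> tr R_u], are linear forms preserved by isomorphisms. If they are
   independent, they form canonical coordinates, in which the MSC has the shape
   [msc a (- d) (1 - d) c b (- a) (1 - a) d] and is a complete invariant; a left
   unit then has second coordinate [tr L = 2] and determines [c] and [d], which
   leaves the two A_1 families. If they are dependent, complete a left unit by a
   vector killed by both forms: the MSC becomes [msc a 0 0 c 0 a b 0], where [a]
   and [b] are fixed by the traces and [c] is unique up to squares. *)

(** * Isomorphisms in coordinates, as systems of polynomial equations *)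

Section Isomorphism.
Variable K : fieldType.

Lemma isomorphic_sym (V W : vectType K) (mulV : {bilinear V -> V -> V})
    (mulW : {bilinear W -> W -> W}) :
  isomorphic mulV mulW -> isomorphic mulW mulV.
Proof.
case=> f [[f' fK f'K] fM].
pose f'L := GRing.isLinear.Build K W V *:%R f' (can2_linear fK f'K).
pose F : {linear W -> V} := HB.pack f' f'L.
exists F; split=> [|u v]; first by exists f.
by apply: (can_inj fK); rewrite fM !f'K.
Qed.

Lemma isomorphic_trans (U V W : vectType K) (mulU : {bilinear U -> U -> U})
    (mulV : {bilinear V -> V -> V}) (mulW : {bilinear W -> W -> W}) :
  isomorphic mulU mulV -> isomorphic mulV mulW -> isomorphic mulU mulW.
Proof.
case=> f [bf fM] [g [bg gM]]; exists (g \o f : {linear U -> W}).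
split=> [|u v]; first exact: bij_comp bg bf.
by rewrite /= fM gM.
Qed.

Lemma sum_ord2 (V : nmodType) (F : 'I_2 -> V) : \sum_i F i = F 0 + F 1.
Proof.
by rewrite !big_ord_recl big_ord0 addr0; congr (_ + F _); exact: val_inj.
Qed.

Lemma msc_mulE (a1 a2 a3 a4 b1 b2 b3 b4 : K) (u v : 'cV[K]_2) :
  ((msc_mul (msc a1 a2 a3 a4 b1 b2 b3 b4) u v 0 0 =
      a1 * (u 0 0 * v 0 0) + a2 * (u 0 0 * v 1 0)
    + a3 * (u 1 0 * v 0 0) + a4 * (u 1 0 * v 1 0))%R *
   (msc_mul (msc a1 a2 a3 a4 b1 b2 b3 b4) u v 1 0 =
      b1 * (u 0 0 * v 0 0) + b2 * (u 0 0 * v 1 0)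
    + b3 * (u 1 0 * v 0 0) + b4 * (u 1 0 * v 1 0))%R)%type.
Proof.
pose c k l : 'I_(2 * 2) := @mxtens_index 2 2 (k, l).
have E (A : 'M[K]_(2, 4)) i : msc_mul A u v i 0 =
    A i (c 0 0) * (u 0 0 * v 0 0) + A i (c 0 1) * (u 0 0 * v 1 0)
  + A i (c 1 0) * (u 1 0 * v 0 0) + A i (c 1 1) * (u 1 0 * v 1 0).
  rewrite mxE.
  rewrite (reindex (@mxtens_index 2 2)) /=; last first.
    by exists (@mxtens_unindex 2 2) => ? _; rewrite (mxtens_indexK, mxtens_unindexK).
  transitivity (\sum_k \sum_l A i (c k l) * (u *t v) (c k l) 0).
    by rewrite pair_bigA; apply: eq_bigr => -[k l].
  rewrite sum_ord2 !sum_ord2 !addrA.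
  by rewrite !mxE !mxtens_indexK /= !ord1.
by split; rewrite E !mxE.
Qed.

Lemma isomorphic_msc_of_basis (V : vectType K) (mul : {bilinear V -> V -> V})
    (e f : V) (a1 a2 a3 a4 b1 b2 b3 b4 : K) :
  basis_of {:V} [:: e; f] ->
  mul e e = a1 *: e + b1 *: f -> mul e f = a2 *: e + b2 *: f ->
  mul f e = a3 *: e + b3 *: f -> mul f f = a4 *: e + b4 *: f ->
  isomorphic mul (msc_mul (msc a1 a2 a3 a4 b1 b2 b3 b4)).
Proof.
move=> ef_basis mul11 mul12 mul21 mul22; apply: isomorphic_sym.
pose F (v : 'cV[K]_2) : V := v 0 0 *: e + v 1 0 *: f.
have F_linear : linear F.
  by move=> k u v; rewrite /F !mxE !scalerDl !scalerDr !scalerA addrACA.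
pose FL := GRing.isLinear.Build K 'cV[K]_2 V *:%R F F_linear.
pose L : {linear 'cV[K]_2 -> V} := HB.pack F FL.
exists L; split.
  exists (fun u => \col_i coord [tuple e; f] i u) => [v|u].
    apply/colP=> i; rewrite mxE.
    have -> : L v = \sum_(j < 2) v j 0 *: [tuple e; f]`_j.
      by rewrite sum_ord2.
    by rewrite coord_sum_free // (basis_free ef_basis).
  rewrite /L /= /F !mxE.
  rewrite [RHS](coord_basis (ef_basis : basis_of fullv [tuple e; f])) ?memvf //.
  by rewrite sum_ord2.
move=> u v; rewrite /L /= /F.
rewrite !msc_mulE.
rewrite linearDl !linearDr /= !linearZl_LR /= !linearZr_LR /=.
rewrite mul11 mul12 mul21 mul22 !scalerDr !scalerA.
rewrite [X in _ = X + _]addrACA [X in _ = _ + X]addrACA [RHS]addrACA -!scalerDl.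
by congr (_ *: e + _ *: f); ring.
Qed.

Lemma det_mx2 (g : 'M[K]_2) : \det g = g 0 0 * g 1 1 - g 0 1 * g 1 0.
Proof.
rewrite (expand_det_row _ 0) sum_ord2 /cofactor !det_mx11 !mxE /= expr0 expr1.
have -> : lift 0 0 = 1 :> 'I_2 by exact: val_inj.
have -> : lift 1 0 = 0 :> 'I_2 by exact: val_inj.
by rewrite mul1r mulN1r mulrN.
Qed.

Lemma isomorphic_msc_unitmx (A B : 'M[K]_(2, 4)) :
  isomorphic (msc_mul A) (msc_mul B) <->
  exists2 g : 'M[K]_2, g \in unitmx &
    forall u v, g *m msc_mul A u v = msc_mul B (g *m u) (g *m v).
Proof.
split=> [/isomorphic_mscP[g gU ->]|[g gU gM]].
  exists g => // u v; rewrite /msc_mul -!mulmxA; congr (_ *m (_ *m _)).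
  by rewrite (tensmx_mul (invmx g) (invmx g) (g *m u) (g *m v)) !mulKmx.
exists (mulmx g); split=> [|u v]; last exact: gM.
by exists (mulmx (invmx g)) => u /=; rewrite ?mulKmx ?mulKVmx.
Qed.

(** By bilinearity it suffices to test multiplicativity on pairs of basis vectors, whose images are
    [(x, z)] and [(y, w)]. *)
Lemma isomorphic_msc_coefs
    (a1 a2 a3 a4 b1 b2 b3 b4 a1' a2' a3' a4' b1' b2' b3' b4' : K) :
  let qa s t s' t' :=
    a1' * (s * s') + a2' * (s * t') + a3' * (t * s') + a4' * (t * t') in
  let qb s t s' t' :=
    b1' * (s * s') + b2' * (s * t') + b3' * (t * s') + b4' * (t * t') in
  isomorphic (msc_mul (msc a1 a2 a3 a4 b1 b2 b3 b4))
             (msc_mul (msc a1' a2' a3' a4' b1' b2' b3' b4')) <->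
  exists x y z w : K,
    [/\ x * w - y * z != 0,
        x * a1 + y * b1 = qa x z x z /\ z * a1 + w * b1 = qb x z x z,
        x * a2 + y * b2 = qa x z y w /\ z * a2 + w * b2 = qb x z y w,
        x * a3 + y * b3 = qa y w x z /\ z * a3 + w * b3 = qb y w x z &
        x * a4 + y * b4 = qa y w y w /\ z * a4 + w * b4 = qb y w y w].
Proof.
move=> qa qb.
have mulE (g : 'M[K]_2) (u : 'cV[K]_2) i :
    (g *m u) i 0 = g i 0 * u 0 0 + g i 1 * u 1 0 by rewrite mxE sum_ord2.
split=> [/isomorphic_msc_unitmx[g gU gM]|].
  exists (g 0 0), (g 0 1), (g 1 0), (g 1 1).
  have prod i j k := congr1 (fun c : 'cV_2 => c k 0)
    (gM (delta_mx i 0) (delta_mx j 0)).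
  split; first by rewrite -det_mx2 -unitfE.
  - have := prod 0 0 0; have := prod 0 0 1.
    by rewrite !mulE !msc_mulE !mulE !mxE /= !mulr1 !mulr0 !addr0.
  - have := prod 0 1 0; have := prod 0 1 1.
    by rewrite !mulE !msc_mulE !mulE !mxE /= !mulr1 !mulr0 !addr0 !add0r.
  - have := prod 1 0 0; have := prod 1 0 1.
    by rewrite !mulE !msc_mulE !mulE !mxE /= !mulr1 !mulr0 !addr0 !add0r.
  - have := prod 1 1 0; have := prod 1 1 1.
    by rewrite !mulE !msc_mulE !mulE !mxE /= !mulr1 !mulr0 !addr0 !add0r.
case=> x [y [z [w [det_neq0 [qa11 qb11] [qa12 qb12] [qa21 qb21] [qa22 qb22]]]]].
pose g : 'M[K]_2 := \matrix_(i, j) if i == 0 then if j == 0 then x else y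
                                   else if j == 0 then z else w.
have gE : (g 0 0 = x) * (g 0 1 = y) * (g 1 0 = z) * (g 1 1 = w).
  by rewrite !mxE.
apply/isomorphic_msc_unitmx; exists g => [|u v].
  by rewrite unitmxE det_mx2 !gE unitfE.
(* Grouping by products of coordinates exposes the entries of [g *m A], which the hypotheses
   rewrite. *)
have gmulE (s t : K) (u0 u1 v0 v1 : K) :
    s * (a1 * (u0 * v0) + a2 * (u0 * v1) + a3 * (u1 * v0) + a4 * (u1 * v1))
  + t * (b1 * (u0 * v0) + b2 * (u0 * v1) + b3 * (u1 * v0) + b4 * (u1 * v1))
  = (s * a1 + t * b1) * (u0 * v0) + (s * a2 + t * b2) * (u0 * v1)
  + (s * a3 + t * b3) * (u1 * v0) + (s * a4 + t * b4) * (u1 * v1) by ring.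
apply/colP=> i; case: (unliftP 0 i) => [j|] ->.
  have -> : lift 0 j = 1 :> 'I_2 by rewrite (ord1 j); exact: val_inj.
  rewrite mulE !msc_mulE !mulE !gE gmulE qb11 qb12 qb21 qb22 /qb; ring.
rewrite mulE !msc_mulE !mulE !gE gmulE qa11 qa12 qa21 qa22 /qa; ring.
Qed.

(** * Traces of left and right multiplication *)

Lemma trace_conj2 (x y z w p11 p12 p21 p22 q11 q12 q21 q22 : K) :
  x * w - y * z != 0 ->
  x * p11 + y * p21 = q11 * x + q12 * z -> x * p12 + y * p22 = q11 * y + q12 * w ->
  z * p11 + w * p21 = q21 * x + q22 * z -> z * p12 + w * p22 = q21 * y + q22 * w ->
  p11 + p22 = q11 + q22.
Proof.
move=> det_neq0 e11 e12 e21 e22; apply: (mulfI det_neq0).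
(* With [G] the matrix of rows [(x, y)] and [(z, w)], the hypotheses say [G P = Q G]; the
   combination is the trace of [adj(G) G P]. *)
transitivity (w * (x * p11 + y * p21) - y * (z * p11 + w * p21)
            - z * (x * p12 + y * p22) + x * (z * p12 + w * p22)); first ring.
by rewrite e11 e12 e21 e22; ring.
Qed.

(** An isomorphism [g] satisfies [g L_u = L_(g u) g], and likewise for [R], so conjugation equates
    the traces. The first pair of trace equations concerns [L], the second [R], at the two basis
    vectors. *)
Lemma isomorphic_msc_traces
    (a1 a2 a3 a4 b1 b2 b3 b4 a1' a2' a3' a4' b1' b2' b3' b4' : K) :
  let qa s t s' t' :=
    a1' * (s * s') + a2' * (s * t') + a3' * (t * s') + a4' * (t * t') in
  let qb s t s' t' :=
    b1' * (s * s') + b2' * (s * t') + b3' * (t * s') + b4' * (t * t') in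
  isomorphic (msc_mul (msc a1 a2 a3 a4 b1 b2 b3 b4))
             (msc_mul (msc a1' a2' a3' a4' b1' b2' b3' b4')) ->
  exists x y z w : K,
    [/\ x * w - y * z != 0,
        a1 + b2 = (a1' + b2') * x + (a3' + b4') * z
          /\ a3 + b4 = (a1' + b2') * y + (a3' + b4') * w,
        a1 + b3 = (a1' + b3') * x + (a2' + b4') * z
          /\ a2 + b4 = (a1' + b3') * y + (a2' + b4') * w,
        [/\ x * a1 + y * b1 = qa x z x z, x * a2 + y * b2 = qa x z y w,
            x * a3 + y * b3 = qa y w x z & x * a4 + y * b4 = qa y w y w] &
        [/\ z * a1 + w * b1 = qb x z x z, z * a2 + w * b2 = qb x z y w,
            z * a3 + w * b3 = qb y w x z & z * a4 + w * b4 = qb y w y w]].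
Proof.
move=> qa qb /isomorphic_msc_coefs[x [y [z [w [det_neq0]]]]].
move=> [qa11 qb11] [qa12 qb12] [qa21 qb21] [qa22 qb22].
exists x, y, z, w; split=> //; split.
- have -> : (a1' + b2') * x + (a3' + b4') * z =
            (a1' * x + a3' * z) + (b2' * x + b4' * z) by ring.
  apply: (trace_conj2 x y z w _ a2 b1 _ _ (a2' * x + a4' * z)
           (b1' * x + b3' * z) _ det_neq0);
    rewrite ?(qa11, qb11, qa12, qb12) /qa /qb; ring.
- have -> : (a1' + b2') * y + (a3' + b4') * w =
            (a1' * y + a3' * w) + (b2' * y + b4' * w) by ring.
  apply: (trace_conj2 x y z w _ a4 b3 _ _ (a2' * y + a4' * w)
           (b1' * y + b3' * w) _ det_neq0);
    rewrite ?(qa21, qb21, qa22, qb22) /qa /qb; ring.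
- have -> : (a1' + b3') * x + (a2' + b4') * z =
            (a1' * x + a2' * z) + (b3' * x + b4' * z) by ring.
  apply: (trace_conj2 x y z w _ a3 b1 _ _ (a3' * x + a4' * z)
           (b1' * x + b2' * z) _ det_neq0);
    rewrite ?(qa11, qb11, qa21, qb21) /qa /qb; ring.
- have -> : (a1' + b3') * y + (a2' + b4') * w =
            (a1' * y + a2' * w) + (b3' * y + b4' * w) by ring.
  apply: (trace_conj2 x y z w _ a4 b2 _ _ (a3' * y + a4' * w)
           (b1' * y + b2' * w) _ det_neq0);
    rewrite ?(qa12, qb12, qa22, qb22) /qa /qb; ring.
Qed.

(** * Left units *)

Lemma isomorphic_left_unital (V W : vectType K) (mulV : {bilinear V -> V -> V})
    (mulW : {bilinear W -> W -> W}) :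
  isomorphic mulV mulW -> left_unital mulV -> left_unital mulW.
Proof.
case=> f [[f' fK f'K] fM] [e eP]; exists (f e) => u.
by rewrite -{1}(f'K u) -fM eP f'K.
Qed.

Lemma msc_left_unitalP (a1 a2 a3 a4 b1 b2 b3 b4 : K) :
  left_unital (msc_mul (msc a1 a2 a3 a4 b1 b2 b3 b4)) <->
  exists s t, [/\ s * a1 + t * a3 = 1, s * a2 + t * a4 = 0,
                  s * b1 + t * b3 = 0 & s * b2 + t * b4 = 1].
Proof.
split=> [[e eP]|[s [t [e11 e12 e21 e22]]]].
  exists (e 0 0), (e 1 0).
  have prod i j := congr1 (fun c : 'cV_2 => c i 0) (eP (delta_mx j 0)).
  move: (prod 0 0) (prod 0 1) (prod 1 0) (prod 1 1).
  rewrite !msc_mulE !mxE /= !(mulr0, mulr1, addr0, add0r).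
  by rewrite !(mulrC (e _ _)).
exists (\col_i if i == 0 then s else t) => u.
apply/colP=> i; case: (unliftP 0 i) => [j|] ->.
  have -> : lift 0 j = 1 :> 'I_2 by rewrite (ord1 j); exact: val_inj.
  (* The target is expanded as [0 * u 0 0 + 1 * u 1 0], with 0 and 1 replaced by the left sides of
     [e21] and [e22]. *)
  rewrite msc_mulE !mxE /= -[RHS]mul1r -e22 -[RHS]add0r.
  rewrite -[X in _ = X + _](mul0r (u 0 0)) -e21; ring.
rewrite msc_mulE !mxE /= -[RHS]mul1r -e11 -[RHS]add0r.
rewrite -[X in _ = X + _](mul0r (u 1 0)) -e12; ring.
Qed.

(** The left unit, non-zero because the multiplication is, serves as first basis vector; this fixes
    two of the four products. *)
Lemma left_unital_basis (V : vectType K) (mul : {bilinear V -> V -> V}) :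
  \dim {:V} = 2%N -> nontrivial mul -> left_unital mul ->
  exists p q r s,
    isomorphic mul (msc_mul (msc 1 0 p r 0 1 q s)).
Proof.
move=> dimV [u [v uv_neq0]] [e eP].
have e_neq0 : e != 0.
  apply/eqP=> e0; apply: uv_neq0; rewrite -(eP (mul u v)) e0.
  exact: linear0l.
have [f fNe] : exists f, f \notin <[e]>%VS.
  have /subvPn[f _ fNe] : ~~ (fullv <= <[e]>)%VS.
    by apply/negP=> /dimvS; rewrite dimV dim_vline e_neq0.
  by exists f.
have ef_basis : basis_of {:V} [:: e; f].
  rewrite basisEfree subvf /= dimV leqnn andbT.
  have ef_fe : perm_eq [:: e; f] [:: f; e] := permEl (perm_catC [:: e] [:: f]).
  by rewrite (perm_free ef_fe) free_cons span_seq1 fNe seq1_free.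
have decomp x : exists c d, x = c *: e + d *: f.
  have := coord_basis (ef_basis : basis_of fullv [tuple e; f]) (memvf x).
  by rewrite sum_ord2 => xE; do 2!eexists; exact: xE.
have [p [q fe]] := decomp (mul f e).
have [r [s ff]] := decomp (mul f f).
exists p, q, r, s; apply: isomorphic_msc_of_basis ef_basis _ _ fe ff.
  by rewrite eP scale1r scale0r addr0.
by rewrite eP scale1r scale0r add0r.
Qed.

End Isomorphism.

(** * Invariants of the two normal forms *)

Section Classification.
Variable R : rcfType.

Lemma dual_trace_msc_inj (a b c d a' b' c' d' : R) :
  isomorphic (msc_mul (msc a (- d) (1 - d) c b (- a) (1 - a) d))
             (msc_mul (msc a' (- d') (1 - d') c' b' (- a') (1 - a') d')) ->
  [/\ a = a', b = b', c = c' & d = d'].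
Proof.
case/isomorphic_msc_traces=> x [y [z [w [_ [? ?] [? ?]]]]].
(* In this shape [tr R] and [tr L] are the first and second coordinates, so preserving them forces
   the identity. *)
have [-> -> -> ->] : [/\ x = 1, y = 0, z = 0 & w = 1] by split; lra.
by case=> ? _ _ ? [? _ _ ?]; split; lra.
Qed.

(** The trace forms are the coordinates in the first algebra, but both are multiples of the first
    coordinate in the second. *)
Lemma dual_trace_diag_not_isomorphic (a b c d a' b' c' : R) :
  ~ isomorphic (msc_mul (msc a (- d) (1 - d) c b (- a) (1 - a) d))
               (msc_mul (msc a' 0 0 c' 0 a' b' 0)).
Proof.
case/isomorphic_msc_traces=> x [y [z [w []]]] _ [? ?] [? ?] _ _.
have : (a' + a') * x = 0 by lra.
have : (a' + a') * y = 1 by lra.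
have : (a' + b') * x = 1 by lra.
have : (a' + b') * y = 0 by lra.
(* [(a' + a') * (a' + b') * x * y] would be both 0 and 1. *)
nra.
Qed.

(* The trace of right multiplication on [msc a 0 0 c 0 a b 0] is
   [(a + b) * x1], so this fixes the scaling of the first basis vector. *)
Definition diag_normalized (a b : R) : Prop :=
  a + b = 1 \/ a = 1 / 2 /\ b = - (1 / 2).

(** The traces force [x = 1] and [y = 0]. The second basis vector then maps to [w] times its
    counterpart, so [c] changes by [w ^+ 2]. *)
Lemma diag_msc_isomorphic (a b c a' b' c' : R) : a != 0 ->
  diag_normalized a b -> diag_normalized a' b' ->
  isomorphic (msc_mul (msc a 0 0 c 0 a b 0))
             (msc_mul (msc a' 0 0 c' 0 a' b' 0)) ->
  [/\ a = a', b = b' & exists2 w, w != 0 & c = w ^+ 2 * c'].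
Proof.
move=> /eqP a0 abN abN' /isomorphic_msc_traces[x [y [z [w]]]] /=.
rewrite !(mulr0, mul0r, mulr1, mul1r, addr0, add0r).
case=> /eqP det [ax ay] [abx _] [_ _ _ cE] _.
have a'0 : a' <> 0 by move=> a'0; apply: a0; rewrite a'0 in ax; lra.
have y0 : y = 0.
  by have /eqP : a' * y = 0; [lra | rewrite mulf_eq0 => /orP[/eqP|/eqP]].
have x1 : x = 1.
  (* If [tr R] is non-zero it fixes [x], otherwise [tr L] does; the mixed cases fail because the
     vanishing of [tr R] is invariant. *)
  case: abN abN' => [ab1|[aE bE]] [ab1'|[a'E b'E]].
  - by rewrite ab1 ab1' mul1r in abx; rewrite -abx.
  - by exfalso; rewrite ab1 a'E b'E in abx; lra.
  - exfalso; have x0 : x = 0 by rewrite ab1' aE bE in abx; lra.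
    by rewrite aE x0 in ax; lra.
  - by rewrite aE a'E in ax; lra.
rewrite x1 y0 in ax abx cE det.
split; [lra | lra |]; exists w; last by rewrite expr2; lra.
by apply/eqP=> w0; apply: det; rewrite w0; ring.
Qed.

(** * The canonical list *)

Lemma admissible_forms (c : canon R) : admissible c ->
  (exists a b k d,
     canon_msc c = msc a (- d) (1 - d) k b (- a) (1 - a) d) \/
  (exists a b k, [/\ canon_msc c = msc a 0 0 k 0 a b 0, a != 0,
     diag_normalized a b & [\/ k = 0, k = 1 | k = -1]]).
Proof.
case: c => /= [a b /eqP b0|a _|a /eqP a0|a /eqP a0|a /eqP a0|_|_|_].
- left; exists a, b, ((2 * a - 4 * a ^+ 2 + 2 * a ^+ 3 - b + a * b) / (2 * b ^+ 2)).
  by exists ((- (2 * a) + 2 * a ^+ 2 + b) / (2 * b)); congr msc; field.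
- left; exists 1, 0, (1 / 2 * (a + 2 * a ^+ 2)), (- a).
  by rewrite opprK subrr.
all: right.
1-3: exists a, (- a + 1); eexists; split; [by [] | by [] | left; ring |].
1-3: by [constructor 2 | constructor 3 | constructor 1].
all: exists (1 / 2), (- (1 / 2)); eexists; split; [by [] | | by right |].
all: rewrite ?mul1r ?invr_eq0 ?pnatr_eq0 //.
all: by [constructor 2 | constructor 3 | constructor 1].
Qed.

Lemma msc_inj (a1 a2 a3 a4 b1 b2 b3 b4 a1' a2' a3' a4' b1' b2' b3' b4' : R) :
  msc a1 a2 a3 a4 b1 b2 b3 b4 = msc a1' a2' a3' a4' b1' b2' b3' b4' ->
  [/\ a1 = a1', a2 = a2', a3 = a3' & a4 = a4'] /\
  [/\ b1 = b1', b2 = b2', b3 = b3' & b4 = b4'].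
Proof.
move=> AB; have E i j := congr1 (fun A : 'M_(2, 4) => A i j) AB.
split; split;
  [move: (E 0 0) | move: (E 0 1) | move: (E 0 2%:R) | move: (E 0 3%:R)
  |move: (E 1 0) | move: (E 1 1) | move: (E 1 2%:R) | move: (E 1 3%:R)];
  by rewrite !mxE.
Qed.

Lemma canon_msc_inj (c d : canon R) : admissible c -> admissible d ->
  canon_msc c = canon_msc d -> c = d.
Proof.
case: c => [a b|a|a|a|a|||]; case: d => [a' b'|a'|a'|a'|a'|||] //= ? ?;
  case/msc_inj=> -[? ? _ ?] [? ? ? _]; try (exfalso; lra); f_equal; lra.
Qed.

Lemma canon_isomorphic_eq (c d : canon R) : admissible c -> admissible d ->
  isomorphic (msc_mul (canon_msc c)) (msc_mul (canon_msc d)) -> c = d.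
Proof.
move=> cA dA cd; apply: canon_msc_inj => //.
have [[a [b [k [e cE]]]]|[a [b [k [cE a0 ab kE]]]]] := admissible_forms c cA;
have [[a' [b' [k' [e' dE]]]]|[a' [b' [k' [dE a0' ab' kE']]]]] := admissible_forms d dA;
rewrite cE dE in cd *.
- by have [-> -> -> ->] := dual_trace_msc_inj _ _ _ _ _ _ _ _ cd.
- by have := dual_trace_diag_not_isomorphic _ _ _ _ _ _ _ cd.
- by have := dual_trace_diag_not_isomorphic _ _ _ _ _ _ _ (isomorphic_sym _ _ _ _ _ cd).
have [-> -> [w w0 kw]] := diag_msc_isomorphic _ _ _ _ _ _ a0 ab ab' cd.
suff -> : k = k' by [].
(* A positive factor preserves the sign, which tells 0, 1 and -1 apart. *)
have : 0 < w ^+ 2 by rewrite exprn_even_gt0.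
by case: kE kw => ->; case: kE' => -> // *; lra.
Qed.

Lemma canon_left_unital (c : canon R) : admissible c ->
  left_unital (msc_mul (canon_msc c)).
Proof.
case: c => [a b|a|a|a|a|||] /= adm; apply/msc_left_unitalP.
(* In the two [A1] families [tr L = 2] makes the second coordinate of the unit 2, and a linear
   equation gives the first. In the others the unit is the first basis vector divided by its
   coefficient [a], or by 1/2. *)
- by exists (2 * (a - 1) / b), 2; split; field; exact/eqP.
- by exists (- (1 + 2 * a)), 2; split; field.
- by exists a^-1, 0; split; field; exact/eqP.
- by exists a^-1, 0; split; field; exact/eqP.
- by exists a^-1, 0; split; field; exact/eqP.
all: by exists 2, 0; split; field.
Qed.

Lemma left_unital_nontrivial_msc (A : 'M[R]_(2, 4)) :
  left_unital (msc_mul A) -> nontrivial (msc_mul A).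
Proof.
case=> e eP; exists e, (const_mx 1); rewrite eP => /(congr1 (fun c : 'cV_2 => c 0 0)).
by rewrite !mxE => /eqP; rewrite oner_eq0.
Qed.

(** * Reduction to the canonical list *)

Lemma left_unital_dual_trace (a b c d : R) :
  left_unital (msc_mul (msc a (- d) (1 - d) c b (- a) (1 - a) d)) ->
  exists2 c0 : canon R, admissible c0 &
    canon_msc c0 = msc a (- d) (1 - d) c b (- a) (1 - a) d.
Proof.
case/msc_left_unitalP=> s [t [e11 e12 e21 e22]].
(* The sum of [e11] and [e22]. *)
have t2 : t = 2 by lra.
rewrite {}t2 in e11 e12 e21 e22.
(* If [b = 0], [e21] forces [a = 1] and [d] stays free. Otherwise [e21] determines [s], then [e11]
   gives [d] and [e12] gives [c]. *)
have [b0|/eqP b0] := eqVneq b 0.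
  have a1 : a = 1 by rewrite b0 in e21; lra.
  exists (A1_spec (- d)) => //=; rewrite b0 a1 in e11 e12 *.
  have sE : s = 2 * d - 1 by lra.
  rewrite sE in e12; have cE : c = d * (2 * d - 1) / 2 by lra.
  by rewrite cE; congr msc; field.
exists (A1_gen a b) => //=.
have sE : s = 2 * (a - 1) / b.
  have : s * b = 2 * (a - 1) by lra.
  by move=> <-; field; exact/eqP.
have dE : d = (1 + a * s) / 2 by lra.
have cE : c = s * d / 2 by lra.
by rewrite cE dE sE; congr msc; field; exact/eqP.
Qed.

(* The new coordinates are the traces of right and left multiplication. *)
Lemma isomorphic_dual_trace (p q r s : R) :
  (1 + q) * (p + s) - 2 * s != 0 ->
  exists a b c d, isomorphic (msc_mul (msc 1 0 p r 0 1 q s))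
     (msc_mul (msc a (- d) (1 - d) c b (- a) (1 - a) d)).
Proof.
move=> det_neq0; pose D := (1 + q) * (p + s) - s * 2.
have D0 : D != 0 by rewrite /D (mulrC s).
pose prod u0 u1 v0 v1 := (u0 * v0 + u1 * v0 * p + u1 * v1 * r,
                          u0 * v1 + u1 * v0 * q + u1 * v1 * s).
pose trR (u : R * R) := (1 + q) * u.1 + s * u.2.
pose trL (u : R * R) := 2 * u.1 + (p + s) * u.2.
(* [x] and [y] are the squares of the vectors of the basis dual to [trR], [trL]. They give all
   parameters, since the traces fix the mixed products. *)
pose x := prod ((p + s) / D) (- 2 / D) ((p + s) / D) (- 2 / D).
pose y := prod (- s / D) ((1 + q) / D) (- s / D) ((1 + q) / D).
exists (trR x), (trL x), (trR y), (trL y).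
apply/isomorphic_msc_coefs; exists (1 + q), s, 2, (p + s).
split; first by [].
all: split; rewrite /trR /trL /x /y /prod /= /D; field; exact: D0.
Qed.

(** Let [e], [f] be the original basis and [h = (p + s) / 2]. The vector [n = f - h e] is killed by
    both trace forms, [n e = q n], and [n n] is [e] times the left side of the last hypothesis. The
    new basis is [a e], [n / w]. *)
Lemma isomorphic_diag (p q r s a c w : R) :
  (1 + q) * (p + s) = 2 * s -> a != 0 -> w != 0 ->
  r - (p + s) * p / 2 + (p + s) ^+ 2 / 4 = a * w ^+ 2 * c ->
  isomorphic (msc_mul (msc 1 0 p r 0 1 q s))
    (msc_mul (msc a 0 0 c 0 a (q * a) 0)).
Proof.
move=> det0 a0 w0 rE; apply/isomorphic_msc_coefs.
pose h := (p + s) / 2.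
have pE : p = h * (1 - q) by rewrite /h; lra.
have sE : s = h * (1 + q) by rewrite /h; lra.
have {}rE : r = a * w ^+ 2 * c + h * p - h ^+ 2 by rewrite -rE /h; field.
(* The new coordinates of [e] are [(1 / a, 0)], those of [f] are [(h / a, w)]. *)
exists a^-1, (h / a), 0, w; clearbody h; split.
- by rewrite mulr0 subr0 mulf_neq0 ?invr_eq0.
all: by split; rewrite ?rE ?sE ?pE; field.
Qed.

Lemma canon_exists (p q r s : R) :
  exists2 c : canon R, admissible c &
    isomorphic (msc_mul (msc 1 0 p r 0 1 q s)) (msc_mul (canon_msc c)).
Proof.
(* The determinant of the two trace forms. *)
have [det0|det_neq0] := eqVneq ((1 + q) * (p + s) - 2 * s) 0; last first.
  have [a [b [c [d iso_d]]]] := isomorphic_dual_trace p q r s det_neq0.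
  have [|c0 adm cE] := left_unital_dual_trace a b c d.
    apply: isomorphic_left_unital iso_d _.
    by apply/msc_left_unitalP; exists 1, 0; split; ring.
  by exists c0 => //; rewrite cE.
have {}det0 : (1 + q) * (p + s) = 2 * s by lra.
pose rho := r - (p + s) * p / 2 + (p + s) ^+ 2 / 4.
have normalize (a : R) : a != 0 -> exists2 c, [\/ c = 0, c = 1 | c = -1] &
    isomorphic (msc_mul (msc 1 0 p r 0 1 q s))
      (msc_mul (msc a 0 0 c 0 a (q * a) 0)).
  move=> a0; have [rho0|rho_neq0] := eqVneq rho 0.
    exists 0; first by constructor 1.
    by apply: (isomorphic_diag _ _ _ _ _ _ 1) => //;
      rewrite ?oner_eq0 -?/rho ?rho0 ?mulr0.
  have ra_neq0 : rho / a != 0 by rewrite mulf_neq0 ?invr_eq0.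
  (* Dividing [n] by the square root of the absolute value of [rho / a] leaves only the sign. *)
  exists (Num.sg (rho / a)).
    by case: sgrP ra_neq0; rewrite ?eqxx //; [constructor 2 | constructor 3].
  apply: (isomorphic_diag _ _ _ _ _ _ (Num.sqrt `|rho / a|)) => //.
    by rewrite sqrtr_eq0 -ltNge normr_gt0.
  rewrite -/rho sqr_sqrtr // -mulrA [_ * Num.sg _]mulrC -numEsg.
  by rewrite [RHS]mulrC divfK.
(* The new first basis vector has [tr R = (1 + q) * a] and [tr L = 2 * a]; [a] is chosen to make
   [tr R] equal to 1, or [tr L] if [tr R] vanishes. *)
have [qN1|q1] := eqVneq (1 + q) 0.
  have h0 : 1 / 2 != 0 :> R by rewrite mul1r invr_eq0 pnatr_eq0.
  have [c cE iso_c] := normalize (1 / 2) h0.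
  have qE : q * (1 / 2) = - (1 / 2) by have -> : q = -1; [lra | rewrite mulN1r].
  by case: cE iso_c => ->; rewrite qE => iso_c;
    [exists (A10 R) | exists (A7 R) | exists (A8 R)].
have a0 : (1 + q)^-1 != 0 by rewrite invr_eq0.
have [c cE iso_c] := normalize (1 + q)^-1 a0.
have qE : q * (1 + q)^-1 = - (1 + q)^-1 + 1 by field.
case: cE iso_c => ->; rewrite qE => iso_c;
  [exists (A5 (1 + q)^-1) | exists (A2 (1 + q)^-1) | exists (A3 (1 + q)^-1)] => //;
  exact/eqP.
Qed.
End Classification.


Theorem theorem5p2 (R : realType) :
  [/\ (* each algebra of the list is non-trivial and left unital *)
      forall c : canon R, admissible c ->
        nontrivial (msc_mul (canon_msc c)) /\
        left_unital (msc_mul (canon_msc c)),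
      (* the algebras of the list are pairwise non-isomorphic *)
      forall c d : canon R, admissible c -> admissible d ->
        isomorphic (msc_mul (canon_msc c)) (msc_mul (canon_msc d)) -> c = d
    & (* every algebra is isomorphic to exactly one of the list *)
      forall (V : vectType R) (mul : {bilinear V -> V -> V}),
        \dim {:V} = 2%N -> nontrivial mul -> left_unital mul ->
        exists! c : canon R,
          admissible c /\ isomorphic mul (msc_mul (canon_msc c))].
Proof.
split=> [c adm|c d|V mul dimV mul_neq0 mul_unital].
- have unital := canon_left_unital R c adm.
  by split; first exact: left_unital_nontrivial_msc unital.
- exact: canon_isomorphic_eq.
have [p [q [r [s iso_mul]]]] := left_unital_basis R V mul dimV mul_neq0 mul_unital.
have [c adm iso_c] := canon_exists R p q r s.
have iso_mul_c := isomorphic_trans _ _ _ _ _ _ _ iso_mul iso_c.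
exists c; split=> // d [adm_d iso_mul_d]; apply: canon_isomorphic_eq => //.
exact: isomorphic_trans _ _ _ _ _ _ _ (isomorphic_sym _ _ _ _ _ iso_mul_c) iso_mul_d.
Qed.
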